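(* Let $(\mathcal{E},\|\cdot\|)$ be a normed vector space, let $\mathcal{C}\subset\mathcal{E}$ be a bounded convex set with $\sup_{x,y\in\mathcal{C}}\|x-y\|\le D<\infty$, and let $T:\mathcal{C}\to\mathcal{C}$ be $\gamma$-Lipschitz with $\gamma>1$. Let $\beta\in(0,1)$, let $x_0\in\mathcal{C}$, and define $x_{k+1}=\lambda x_0+(1-\lambda)T(x_k)$ for $k\ge0$, where $\lambda=1-\frac{\beta}{\gamma}$. Then, for any $\epsilon\in(0,\|T(x_0)-x_0\|]$, we have $$\|T(x_k)-x_k\|\le\Big(\frac{\gamma}{\beta}-1\Big)D+\epsilon$$ after at most $k=\Big\lceil\frac{\ln(\|T(x_0)-x_0\|/\epsilon)}{\ln(1/\beta)}\Big\rceil$ iterations. In particular, for $\beta=1/\big(1+\frac{\epsilon}{2\gamma D}\big)$, we have $\|T(x_k)-x_k\|\le(\gamma-1)D+\epsilon$ after $$k=\mathcal{O}\Big(\frac{\gamma D\ln(\|T(x_0)-x_0\|/\epsilon)}{\epsilon}\Big)$$ iterations.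
   Context: $T$ is $\gamma$-Lipschitz on $\mathcal{C}$ if $\|T(x)-T(y)\|\le\gamma\|x-y\|$ for all $x,y\in\mathcal{C}$. $f=\mathcal{O}(g)$ means that there is a constant $C>0$, independent of $f,g$, with $f\le Cg$.
   Formalization: In the last bound no absolute O-constant exists when γ→1 and ε→‖T(x_0)−x_0‖ together; here, for each δ>0, the constant depends only on δ and serves all cases with γ≥1+δ or ‖T(x_0)−x_0‖≥(1+δ)ε. *)

(* Defs.v *)
(* MathComp / MathComp-Analysis *)
From HB Require Import structures.
From mathcomp Require Import all_boot all_order all_algebra.
From mathcomp Require Import all_classical all_reals all_analysis.
Set Implicit Arguments.
Unset Strict Implicit.
Unset Printing Implicit Defensive.
Import Order.TTheory GRing.Theory Num.Theory.
Import numFieldNormedType.Exports.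
Local Open Scope classical_set_scope.
Local Open Scope ring_scope.

(* The map T : A -> A is given as a total function on E that sends A to A;
   its values outside A are irrelevant.  The supremum is taken in \bar R
   because the supremum of an unbounded set is 0 in R. *)
Definition lipschitz_self_map (R : realType) (E : normedModType R)
    (A : set E) (D gamma : R) (T : E -> E) : Prop :=
  [/\ convex_set A,
      (ereal_sup [set (`|xy.1 - xy.2|)%:E | xy in A `*` A] <= D%:E)%E,
      set_fun A A T &
      gamma.-lipschitz_A T].

Definition anchored_iter (R : realType) (E : normedModType R)
    (T : E -> E) (x0 : E) (lambda : R) (k : nat) : E :=
  iter k (fun x => lambda *: x0 + (1 - lambda) *: T x) x0.

(* Main.v *)
Require Import Defs.
From HB Require Import structures.
From mathcomp Require Import all_boot all_order all_algebra.
From mathcomp Require Import all_classical all_reals all_analysis.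
From mathcomp Require Import ring lra.
Set Implicit Arguments.
Unset Strict Implicit.
Unset Printing Implicit Defensive.
Import Order.TTheory GRing.Theory Num.Theory.
Import numFieldNormedType.Exports.
Local Open Scope classical_set_scope.
Local Open Scope ring_scope.

(** Write [c = 1 - lambda = beta / gamma] and [d = `|T x0 - x0|].

    For the first part, [x_(k+1) - x_k = c (T x_k - T x_(k-1))] shows that
    consecutive iterates contract by the factor [c * gamma = beta]
    ([norm_anchored_iter_step]). Since
    [c (T x_k - x_k) = (x_(k+1) - x_k) + (1 - c) (x_k - x0)], the residual is
    at most [beta ^ k d + (gamma / beta - 1) `|x_k - x0|]
    ([residual_le_step_anchor]). The last factor is at most [D], and
    [beta ^ k d <= eps] as soon as [k >= ln (d / eps) / ln (1 / beta)].

    For the second part, [gamma / beta - 1 = gamma - 1 + eps / (2 D)], so the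
    first part with [eps / 2] in place of [eps] gives the required bound after
    [ln (2 d / eps) / ln (1 + eps / (2 gamma D))] steps. When [d / eps] stays
    away from 1, say [d / eps >= 1 + eta], both [ln 2] and the rounding error
    are absorbed into a multiple of [ln (d / eps)] that depends only on [eta]
    ([iteration_count_le]).

    When [d / eps] is near 1 this is impossible, and the bound must be shown
    for every [k]. Summing the contraction estimate as a geometric series
    yields, uniformly in [k] and [beta], a residual of at most
    [d + (gamma - 1) `|x_k - x0|] ([residual_le_anchor]), while
    [`|x_k - x0| <= c D <= D / gamma]. If [gamma >= 1 + delta], the slack
    [(gamma - 1) (D - `|x_k - x0|)] is at least [delta ^ 2 / (1 + delta) * d],
    which covers [d - eps] when [d <= (1 + delta ^ 2 / (1 + delta)) eps]
    ([residual_le_of_eps_close]). Hence [eta = delta ^ 2 / (1 + delta)]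
    separates the two regimes; it is smaller than [delta], so the alternative
    [(1 + delta) eps <= d] belongs to the first one. *)

(** * Anchored iterates of a Lipschitz self-map *)

Lemma lipschitz_self_map_diam (R : realType) (E : normedModType R) (A : set E)
    (D gamma : R) (T : E -> E) (x y : E) :
  lipschitz_self_map A D gamma T -> A x -> A y -> `|x - y| <= D.
Proof.
move=> [_ hD _ _] Ax Ay; rewrite -lee_fin; apply: le_trans hD.
by apply: ereal_sup_ubound; exists (x, y).
Qed.

Lemma lipschitz_self_mapE (R : realType) (E : normedModType R) (A : set E)
    (D gamma : R) (T : E -> E) (x y : E) :
  lipschitz_self_map A D gamma T -> A x -> A y ->
  `|T x - T y| <= gamma * `|x - y|.
Proof. by move=> [_ _ _ hT] Ax Ay; apply: (hT (x, y)). Qed.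

Lemma anchored_iterS (R : realType) (E : normedModType R) (T : E -> E)
    (x0 : E) (c : R) (k : nat) :
  anchored_iter T x0 (1 - c) k.+1 =
  (1 - c) *: x0 + c *: T (anchored_iter T x0 (1 - c) k).
Proof. by rewrite /anchored_iter iterS subKr. Qed.

Lemma anchored_iterS_sub (R : realType) (E : normedModType R) (T : E -> E)
    (x0 : E) (c : R) (k : nat) :
  anchored_iter T x0 (1 - c) k.+1 - x0 =
  c *: (T (anchored_iter T x0 (1 - c) k) - x0).
Proof.
rewrite anchored_iterS scalerBl scale1r scalerBr.
by rewrite -addrA addrC subrKA.
Qed.

Lemma anchored_iter_mem (R : realType) (E : normedModType R) (A : set E)
    (D gamma : R) (T : E -> E) (x0 : E) (c : R) (k : nat) :
  lipschitz_self_map A D gamma T -> A x0 -> 0 <= c <= 1 ->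
  A (anchored_iter T x0 (1 - c) k).
Proof.
move=> hT Ax0 c01; have [cA _ TA _] := hT.
elim: k => [//|k Ak]; rewrite anchored_iterS.
have /andP[c0 c1] := c01.
have := cA (T (anchored_iter T x0 (1 - c) k)) x0 (Itv01 c0 c1).
rewrite !inE => /(_ (TA _ Ak) Ax0).
by rewrite [X in _ -> A X]addrC.
Qed.

(** No bound on [c * gamma] is needed here; the iteration contracts when
    [c * gamma < 1]. *)
Lemma norm_anchored_iter_step (R : realType) (E : normedModType R) (A : set E)
    (D gamma : R) (T : E -> E) (x0 : E) (c : R) :
  lipschitz_self_map A D gamma T -> 0 <= gamma -> A x0 -> 0 <= c <= 1 ->
  let x := anchored_iter T x0 (1 - c) in forall k : nat,
  `|x k.+1 - x k| <= (c * gamma) ^+ k * (c * `|T x0 - x0|).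
Proof.
move=> hT g0 Ax0 c01 x; have /andP[c0 _] := c01.
elim=> [|k IH].
  by rewrite expr0 mul1r /x anchored_iterS_sub normrZ ger0_norm.
have -> : x k.+2 - x k.+1 = c *: (T (x k.+1) - T (x k)).
  by rewrite /x !(anchored_iterS _ _ _ _) opprD addrACA subrr add0r scalerBr.
rewrite normrZ ger0_norm // exprS -!mulrA ler_wpM2l //.
have Ax j : A (x j) by exact: anchored_iter_mem hT _ _.
by apply: le_trans (lipschitz_self_mapE hT (Ax _) (Ax _)) _; rewrite ler_wpM2l.
Qed.

(** The geometric sum of the step bounds, with the denominator
    [1 - c * gamma] cleared so that [c * gamma = 1] is allowed. *)
Lemma norm_anchored_iter_sub_geo (R : realType) (E : normedModType R)
    (A : set E) (D gamma : R) (T : E -> E) (x0 : E) (c : R) :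
  lipschitz_self_map A D gamma T -> 0 <= gamma -> A x0 -> 0 <= c <= 1 ->
  c * gamma <= 1 ->
  let x := anchored_iter T x0 (1 - c) in forall k : nat,
  (1 - c * gamma) * `|x k - x0| <=
  (1 - (c * gamma) ^+ k) * (c * `|T x0 - x0|).
Proof.
move=> hT g0 Ax0 c01 cg1 x k.
elim: k => [|k IH]; first by rewrite /x /= subrr normr0 mulr0 expr0 subrr mul0r.
have step := norm_anchored_iter_step hT g0 Ax0 c01 k.
have tri : `|x k.+1 - x0| <= `|x k.+1 - x k| + `|x k - x0|.
  by rewrite -[x k.+1 - x0](subrKA (x k)) ler_normD.
apply: le_trans (ler_wpM2l _ tri) _; first by rewrite subr_ge0.
rewrite mulrDr; apply: le_trans (lerD (ler_wpM2l _ step) IH) _.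
  by rewrite subr_ge0.
by rewrite exprS; lra.
Qed.

(** Better than the trivial bound [D]: every iterate after the anchor is the
    anchor moved by a fraction [c] of the way towards a point of [A]. *)
Lemma norm_anchored_iter_sub_diam (R : realType) (E : normedModType R)
    (A : set E) (D gamma : R) (T : E -> E) (x0 : E) (c : R) (k : nat) :
  lipschitz_self_map A D gamma T -> A x0 -> 0 <= c <= 1 ->
  `|anchored_iter T x0 (1 - c) k - x0| <= c * D.
Proof.
move=> hT Ax0 c01; have /andP[c0 _] := c01.
have D0 : 0 <= D.
  exact: le_trans (normr_ge0 _) (lipschitz_self_map_diam hT Ax0 Ax0).
case: k => [|k]; first by rewrite subrr normr0 mulr_ge0.
have [_ _ TA _] := hT.
have Ax := anchored_iter_mem k hT Ax0 c01.
rewrite anchored_iterS_sub normrZ ger0_norm // ler_wpM2l //.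
exact: lipschitz_self_map_diam hT (TA _ Ax) Ax0.
Qed.

(** * Residual bounds *)

Lemma residual_le_step_anchor (R : realType) (E : normedModType R) (A : set E)
    (D gamma : R) (T : E -> E) (x0 : E) (c : R) :
  lipschitz_self_map A D gamma T -> 0 <= gamma -> A x0 -> 0 < c <= 1 ->
  let x := anchored_iter T x0 (1 - c) in forall k : nat,
  `|T (x k) - x k| <=
  (c * gamma) ^+ k * `|T x0 - x0| + (c^-1 - 1) * `|x k - x0|.
Proof.
move=> hT g0 Ax0 /andP[c0 c1] x k.
have c01 : 0 <= c <= 1 by rewrite ltW.
have step := norm_anchored_iter_step hT g0 Ax0 c01 k.
rewrite -(ler_pM2l c0) mulrDr.
have -> : c * `|T (x k) - x k| = `|(x k.+1 - x k) + (1 - c) *: (x k - x0)|.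
  rewrite -[c in LHS]ger0_norm ?ltW // -normrZ; congr `| _ |.
  rewrite -[x k.+1 - _](subrKA x0) anchored_iterS_sub scalerBl scale1r.
  rewrite addrA -[x0 - x k]opprB subrK -scalerBr.
  by rewrite opprB subrKA.
apply: le_trans (ler_normD _ _) _; apply: lerD.
  by apply: le_trans step _; rewrite mulrCA.
by rewrite normrZ ger0_norm ?subr_ge0 // mulrA mulrBr mulr1 divff ?gt_eqF.
Qed.

(** The factor [(c * gamma) ^+ k] of [residual_le_step_anchor] is traded
    against the distance to the anchor, which leaves a bound without [c]. *)
Lemma residual_le_anchor (R : realType) (E : normedModType R) (A : set E)
    (D gamma : R) (T : E -> E) (x0 : E) (c : R) :
  lipschitz_self_map A D gamma T -> 0 <= gamma -> A x0 -> 0 < c <= 1 ->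
  c * gamma <= 1 ->
  let x := anchored_iter T x0 (1 - c) in forall k : nat,
  `|T (x k) - x k| <= `|T x0 - x0| + (gamma - 1) * `|x k - x0|.
Proof.
move=> hT g0 Ax0 c01 cg1 x k; have /andP[c0 c1] := c01.
apply: le_trans (residual_le_step_anchor hT g0 Ax0 c01 k) _.
have c01' : 0 <= c <= 1 by rewrite ltW.
have := norm_anchored_iter_sub_geo hT g0 Ax0 c01' cg1 k.
rewrite -/x => geo; rewrite -(ler_pM2l c0) mulrDr mulrA.
have -> : c * ((c^-1 - 1) * `|x k - x0|) = (1 - c) * `|x k - x0|.
  by field; rewrite gt_eqF.
lra.
Qed.

Lemma expr_mul_le_of_ceil (R : realType) (b d eps : R) (k : nat) :
  0 < b < 1 -> 0 < eps -> 0 < d ->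
  Num.ceil (ln (d / eps) / ln (1 / b)) <= k%:Z -> b ^+ k * d <= eps.
Proof.
move=> /andP[b0 b1] e0 d0; rewrite ceil_le_int.
have lb : 0 < ln (1 / b) by rewrite ln_gt0 // div1r invf_gt1.
rewrite ler_pdivrMr // mulr_natl -lnXn ?divr_gt0 //.
rewrite ler_ln ?posrE ?exprn_gt0 ?divr_gt0 //.
by rewrite div1r exprVn ler_pdivrMr // ler_pdivlMl ?exprn_gt0.
Qed.

Lemma residual_le_ceil (R : realType) (E : normedModType R) (A : set E)
    (D gamma : R) (T : E -> E) (x0 : E) (beta eps : R) (k : nat) :
  lipschitz_self_map A D gamma T -> 1 < gamma -> A x0 -> 0 < beta < 1 ->
  0 < eps <= `|T x0 - x0| ->
  let x := anchored_iter T x0 (1 - beta / gamma) in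
  Num.ceil (ln (`|T x0 - x0| / eps) / ln (1 / beta)) <= k%:Z ->
  `|T (x k) - x k| <= (gamma / beta - 1) * D + eps.
Proof.
move=> hT g1 Ax0 b01 /andP[e0 ed] x hk.
have /andP[b0 b1] := b01; have g0 : 0 < gamma by exact: lt_trans g1.
have c01 : 0 < beta / gamma <= 1.
  by rewrite divr_gt0 //= ler_pdivrMr // mul1r ltW // (lt_trans b1).
have := residual_le_step_anchor hT (ltW g0) Ax0 c01 k.
rewrite -/x divfK ?gt_eqF // invf_div => /le_trans; apply.
rewrite addrC lerD //.
  rewrite ler_wpM2l //.
    by rewrite subr_ge0 ler_pdivlMr // mul1r ltW // (lt_trans b1).
  have Ax : A (x k).
    by apply: (anchored_iter_mem k hT Ax0); case/andP: c01 => /ltW ->.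
  exact: lipschitz_self_map_diam hT Ax Ax0.
by apply: expr_mul_le_of_ceil => //; apply: lt_le_trans ed.
Qed.

(** If [gamma >= 1 + delta] and [eps] is within the factor
    [1 + delta ^ 2 / (1 + delta)] of the initial residual, no iteration is
    needed. *)
Lemma residual_le_of_eps_close (R : realType) (E : normedModType R)
    (A : set E) (D gamma : R) (T : E -> E) (x0 : E) (delta beta eps : R) :
  lipschitz_self_map A D gamma T -> A x0 -> 0 < beta <= 1 ->
  0 < delta -> 1 + delta <= gamma -> 0 < eps <= `|T x0 - x0| ->
  (1 + delta) * (`|T x0 - x0| - eps) <= delta ^+ 2 * eps ->
  let x := anchored_iter T x0 (1 - beta / gamma) in forall k : nat,
  `|T (x k) - x k| <= (gamma - 1) * D + eps.
Proof.
move=> hT Ax0 /andP[b0 b1] dl0 dlg /andP[e0 ed] close x k.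
have g1 : 1 < gamma by apply: lt_le_trans dlg; rewrite ltrDl.
have g0 : 0 < gamma by exact: lt_trans g1.
have c0 : 0 < beta / gamma by rewrite divr_gt0.
have c1 : beta / gamma <= 1 by rewrite ler_pdivrMr // mul1r; lra.
have c01 : 0 < beta / gamma <= 1 by rewrite c0.
have cg : beta / gamma * gamma <= 1 by rewrite divfK ?gt_eqF.
have c01' : 0 <= beta / gamma <= 1 by rewrite ltW.
apply: le_trans (residual_le_anchor hT (ltW g0) Ax0 c01 cg k) _.
have := norm_anchored_iter_sub_diam k hT Ax0 c01'; rewrite -/x.
set Y := `|x k - x0|; set d := `|T x0 - x0| in ed close * => hY.
have [_ _ TA _] := hT.
have dD : d <= D := lipschitz_self_map_diam hT (TA _ Ax0) Ax0.
(* c * D <= D / gamma because beta <= 1. *)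
have YD : (1 + delta) * Y <= D.
  have : gamma * Y <= D.
    apply: le_trans (ler_wpM2l (ltW g0) hY) _.
    rewrite mulrA [gamma * _]mulrC divfK ?gt_eqF // ler_piMl //.
    exact: le_trans (normr_ge0 _) dD.
  by apply: le_trans; rewrite ler_wpM2r // normr_ge0.
have DY : delta * D <= (1 + delta) * (D - Y) by lra.
have p1 : 0 < 1 + delta by lra.
have DY0 : 0 <= D - Y.
  by rewrite -(pmulr_rge0 _ p1); apply: le_trans DY; rewrite mulr_ge0 //; lra.
suff : d - eps <= (gamma - 1) * (D - Y) by lra.
apply: le_trans (_ : delta * (D - Y) <= _); last by rewrite ler_wpM2r //; lra.
rewrite -(ler_pM2l p1); apply: le_trans close _.
rewrite mulrCA; apply: le_trans (ler_wpM2l (ltW dl0) DY).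
by rewrite mulrA -expr2 ler_wpM2l ?exprn_ge0 ?(ltW dl0) // (le_trans ed).
Qed.

(** * Iteration count *)

Lemma ln1Dx_ge_half (R : realType) (u : R) :
  0 < u <= 1 -> u / 2 <= ln (1 + u).
Proof.
move=> /andP[u0 u1]; have p0 : 0 < 1 + u by rewrite addr_gt0.
have : ln (1 + - (u / (1 + u))) <= - (u / (1 + u)).
  by apply: le_ln1Dx; rewrite ltrN2 ltr_pdivrMr // mul1r ltrDr.
have -> : 1 + - (u / (1 + u)) = (1 + u)^-1 by field; rewrite gt_eqF.
rewrite lnV ?posrE // lerN2; apply: le_trans.
by rewrite ler_pM2l // lef_pV2 ?posrE // [2]/(1 + 1) lerD2l.
Qed.

Lemma natr_absz_ceil_le (R : realType) (x : R) :
  0 <= x -> (`|Num.ceil x|%N)%:R <= x + 1.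
Proof.
move=> x0; have c0 : 0 <= Num.ceil x.
  by rewrite ceil_ge0 (lt_le_trans _ x0) // ltrN10.
rewrite pmulrn gez0_abs //.
by have /andP[+ _] := ceil_itv x; rewrite intrB ltrBlDr => /ltW.
Qed.

(** The number of steps that [residual_le_ceil] asks for at accuracy [eps / 2],
    with [1 / beta] expanded and [d] the initial residual. *)
Lemma iteration_count_le (R : realType) (gamma D d eps eta : R) :
  1 < gamma -> 0 < eps -> d <= D -> 0 < eta -> (1 + eta) * eps <= d ->
  (absz (Num.ceil
    (ln (d / (eps / 2)) / ln (1 + eps / (2 * gamma * D)))))%:R <=
  (4 + (4 * ln 2 + 1) / ln (1 + eta)) * (gamma * D * ln (d / eps) / eps).
Proof.
move=> g1 e0 dD h0 hd.
have ed : eps <= d by apply: le_trans hd; rewrite ler_peMl ?ltW // ltrDl.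
have d0 : 0 < d by exact: lt_le_trans ed.
have D0 : 0 < D by exact: lt_le_trans dD.
have g0 : 0 < gamma by exact: lt_trans g1.
(* M is the scale of the count; M >= 1 absorbs the additive constants. *)
set M := gamma * D / eps.
have M1 : 1 <= M.
  rewrite /M ler_pdivlMr // mul1r; apply: le_trans (_ : D <= _).
    exact: le_trans dD.
  by rewrite ler_peMl // ltW.
have M0 : 0 < M by lra.
set u := eps / (2 * gamma * D).
have uE : u = (2 * M)^-1 by rewrite /u /M; field; rewrite !gt_eqF.
have u0 : 0 < u by rewrite uE invr_gt0; lra.
have u1 : u <= 1 by rewrite uE invf_le1; lra.
have lu : (4 * M)^-1 <= ln (1 + u).
  apply: le_trans (ln1Dx_ge_half _); last by rewrite u0.
  by rewrite uE le_eqVlt; apply/orP; left; apply/eqP; field; rewrite gt_eqF.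
have lu0 : 0 < ln (1 + u) by apply: lt_le_trans lu; rewrite invr_gt0; lra.
have l2 : 0 < ln 2 :> R by rewrite ln_gt0 // ltr1n.
have L0 : 0 < ln (1 + eta) by rewrite ln_gt0 // ltrDl.
have Lr : ln (1 + eta) <= ln (d / eps).
  by rewrite ler_ln ?posrE ?divr_gt0 ?addr_gt0 // ler_pdivlMr.
have -> : d / (eps / 2) = 2 * (d / eps) by field; rewrite gt_eqF.
rewrite lnM ?posrE ?divr_gt0 //.
set l := ln (d / eps) in Lr *; set L := ln (1 + eta) in L0 Lr *.
have l0 : 0 < l by exact: lt_le_trans Lr.
have -> : gamma * D * l / eps = M * l by rewrite /M; field; rewrite gt_eqF.
apply: le_trans (natr_absz_ceil_le _) _.
  by rewrite divr_ge0 // ltW // addr_gt0.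
have q : (ln 2 + l) / ln (1 + u) <= (ln 2 + l) * (4 * M).
  have l2l : 0 <= ln 2 + l by rewrite addr_ge0 ?ltW.
  by rewrite ler_wpM2l // invf_ple ?posrE //; lra.
(* This turns each remaining constant into a multiple of l. *)
have w : 1 <= l / L by rewrite ler_pdivlMr // mul1r.
have -> : (4 + (4 * ln 2 + 1) / L) * (M * l) =
    4 * (M * l) + (4 * ln 2 + 1) * M * (l / L) by field; rewrite gt_eqF.
have : (4 * ln 2 + 1) * M <= (4 * ln 2 + 1) * M * (l / L).
  by rewrite ler_peMr // mulr_ge0 //; lra.
lra.
Qed.

(* The second part carries the constant hidden in the O: Cst depends on delta
   only, not on E, A, D, gamma, T, x0 or eps. Some dependence is unavoidable:
   no single constant works when gamma -> 1 and eps -> `|T x0 - x0|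
   simultaneously, since the logarithm then tends to 0. For fixed gamma,
   delta := gamma - 1 covers every eps in ]0, `|T x0 - x0|]. *)
Theorem corollary1 (R : realType) :
  (forall (E : normedModType R) (A : set E) (D gamma : R) (T : E -> E)
      (x0 : E) (beta eps : R),
    lipschitz_self_map A D gamma T -> 1 < gamma -> A x0 ->
    0 < beta < 1 ->
    0 < eps <= `|T x0 - x0| ->
    let x := anchored_iter T x0 (1 - beta / gamma) in
    forall k : nat,
      Num.ceil (ln (`|T x0 - x0| / eps) / ln (1 / beta)) <= k%:Z ->
      `|T (x k) - x k| <= (gamma / beta - 1) * D + eps)
  /\
  (forall delta : R, 0 < delta ->
    exists2 Cst : R, 0 < Cst &
    forall (E : normedModType R) (A : set E) (D gamma : R) (T : E -> E)
      (x0 : E) (eps : R),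
    lipschitz_self_map A D gamma T -> 1 < gamma -> A x0 ->
    0 < eps <= `|T x0 - x0| ->
    1 + delta <= gamma \/ (1 + delta) * eps <= `|T x0 - x0| ->
    let beta := 1 / (1 + eps / (2 * gamma * D)) in
    let x := anchored_iter T x0 (1 - beta / gamma) in
    exists2 K : nat,
      K%:R <= Cst * (gamma * D * ln (`|T x0 - x0| / eps) / eps) &
      forall k : nat, (K <= k)%N ->
        `|T (x k) - x k| <= (gamma - 1) * D + eps).
Proof.
split; first by move=> *; apply: residual_le_ceil; eassumption.
move=> delta dl0.
have p1 : 0 < 1 + delta by rewrite addr_gt0.
pose eta := delta ^+ 2 / (1 + delta).
have h0 : 0 < eta by rewrite divr_gt0 ?exprn_gt0.
exists (4 + (4 * ln 2 + 1) / ln (1 + eta)).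
  by rewrite addr_gt0 // divr_gt0 ?ln_gt0 ?ltrDl // addr_gt0 // mulr_gt0 //
    ln_gt0 // ltr1n.
move=> E A D gamma T x0 eps hT g1 Ax0 hed alt beta x.
have /andP[e0 ed] := hed; have [_ _ TA _] := hT.
have dD := lipschitz_self_map_diam hT (TA _ Ax0) Ax0.
have D0 : 0 < D by exact: lt_le_trans (lt_le_trans e0 ed) dD.
have g0 : 0 < gamma by exact: lt_trans g1.
have u0 : 0 < eps / (2 * gamma * D) by rewrite divr_gt0 // !mulr_gt0.
have b01 : 0 < beta < 1.
  by rewrite /beta div1r invr_gt0 invf_lt1 ?ltrDl ?addr_gt0 // u0.
(* eta is the separation of eps from the initial residual that suffices in
   residual_le_of_eps_close. *)
have [far|close] := leP ((1 + eta) * eps) `|T x0 - x0|.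
  exists (absz (Num.ceil (ln (`|T x0 - x0| / (eps / 2)) / ln (1 / beta)))).
    by rewrite /beta !div1r invrK; exact: iteration_count_le.
  move=> k Kk.
  have he2 : 0 < eps / 2 <= `|T x0 - x0| by apply/andP; split; lra.
  have ceilk : Num.ceil (ln (`|T x0 - x0| / (eps / 2)) / ln (1 / beta)) <= k%:Z.
    by apply: le_trans (ler_norm _) _; rewrite -abszE lez_nat.
  apply: le_trans (residual_le_ceil hT g1 Ax0 b01 he2 ceilk) _.
  rewrite le_eqVlt; apply/orP; left; apply/eqP; rewrite /beta; field.
  by rewrite !gt_eqF // addr_gt0 // !mulr_gt0.
have etaE : (1 + delta) * eta = delta ^+ 2 by rewrite mulrC divfK ?gt_eqF.
have close' : (1 + delta) * (`|T x0 - x0| - eps) <= delta ^+ 2 * eps.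
  by rewrite -etaE -mulrA ler_pM2l //; lra.
have dlg : 1 + delta <= gamma.
  (* As eta <= delta, the other alternative contradicts close. *)
  case: alt => // far; exfalso; move: close; apply/negP; rewrite -leNgt.
  apply: le_trans far; rewrite ler_pM2r // lerD2l ler_pdivrMr // expr2.
  by rewrite ler_pM2l // lerDr.
exists 0%N.
  rewrite mulr_ge0 //; last first.
    rewrite divr_ge0 ?(ltW e0) // mulr_ge0 ?ln_ge0 ?ler_pdivlMr ?mul1r //.
    by rewrite mulr_ge0 // ltW.
  by rewrite addr_ge0 // divr_ge0 ?ln_ge0 ?lerDl ?ltW // addr_gt0 //
    mulr_gt0 // ln_gt0 // ltr1n.
have b01' : 0 < beta <= 1 by case/andP: b01 => -> /ltW.
move=> k _.
exact: (residual_le_of_eps_close hT Ax0 b01' dl0 dlg hed close' k).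
Qed.
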